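(* Let $\bar d=(d_j)_{j\ge 0}$ be integers with $d_0=1$ and $d_j\ge 2$ for $j\ge 1$, and let $\bar p=(p_j)_{j\ge 1}$ with $p_j\in(0,1]$. If $\prod_{i=1}^\infty p_i=0$, then the point spectrum $\sigma_p(l^1,\bar d,\bar p)$ is empty.
   Context: $\mathbb{Z}_+=\{0,1,2,\dots\}$. Put $q_j=d_0d_1\cdots d_j$ for $j\ge 0$. Every $n\in\mathbb{Z}_+$ has a unique expansion $n=\sum_{j\ge1}a_j(n)q_{j-1}$ with digits $a_j(n)\in\{0,\dots,d_j-1\}$, only finitely many nonzero. Put $\zeta_n=\min\{j\ge1: a_j(n)\ne d_j-1\}$. Let $S=[s(n,m)]_{n,m\ge0}$ be the stochastic matrix with entries: $s(n,n+1)=\prod_{j=1}^{\zeta_n}p_j$; $s(n,n)=1-p_1$; if $\zeta_n\ge2$, for $1\le r\le\zeta_n-1$, $s\big(n,\,n-\sum_{j=1}^r(d_j-1)q_{j-1}\big)=(1-p_{r+1})\prod_{j=1}^rp_j$; and $s(n,m)=0$ otherwise. Column sums of $S$ are at most $1$, and $(Sw)(n)=\sum_m s(n,m)w(m)$ defines a bounded linear operator on $l^1=l^1(\mathbb{Z}_+)$ (complex sequences). $\sigma_p(l^1,\bar d,\bar p)$ denotes the point spectrum (set of eigenvalues) of $S$ acting on $l^1$. *)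

(* Defs.v *)
From Stdlib Require Import Reals Lra Lia Arith.
From Coquelicot Require Import Coquelicot.

Local Open Scope nat_scope.

Fixpoint q (d : nat -> nat) (j : nat) : nat :=
  match j with
  | 0 => d 0
  | S i => q d i * d (S i)
  end.

(* Meaningful for [1 <= j].  [digit_expansion] and [digit_unique] below show
   that these are the digits of [n] in the mixed-radix system given by [d]. *)
Definition digit (d : nat -> nat) (n j : nat) : nat :=
  (n / q d (j - 1)) mod d j.

Fixpoint first_nonmax (d : nat -> nat) (n fuel j : nat) : nat :=
  match fuel with
  | 0 => j
  | S f => if digit d n j =? d j - 1 then first_nonmax d n f (S j) else j
  end.

(* The least [j >= 1] with [digit d n j <> d j - 1]; since [n < q d n], the
   digit of index [n + 1] is zero and the fuel [n] suffices (see [zeta_spec]). *)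
Definition zeta (d : nat -> nat) (n : nat) : nat := first_nonmax d n n 1.

(* [p 1 * ... * p k]; the value [p 0] is never used. *)
Fixpoint pprod (p : nat -> R) (k : nat) : R :=
  match k with
  | 0 => 1%R
  | S i => (pprod p i * p (S i))%R
  end.

Fixpoint nsum (f : nat -> nat) (k : nat) : nat :=
  match k with
  | 0 => 0
  | S i => nsum f i + f (S i)
  end.

Definition drop (d : nat -> nat) (r : nat) : nat :=
  nsum (fun j => (d j - 1) * q d (j - 1)) r.

(* The columns [n - drop d r], [1 <= r <= zeta d n - 1], are pairwise distinct
   and smaller than [n], so at most one term of the sum is nonzero
   (see [s_drop]).  The sum is empty when [zeta d n = 1]. *)
Definition s (d : nat -> nat) (p : nat -> R) (n m : nat) : R :=
  if m =? n + 1 then pprod p (zeta d n)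
  else if m =? n then (1 - p 1%nat)%R
  else sum_n_m
         (fun r => if m =? n - drop d r
                   then ((1 - p (r + 1)%nat) * pprod p r)%R else 0%R)
         1 (zeta d n - 1).

Definition l1 (w : nat -> C) : Prop := ex_series (fun n => Cmod (w n)).

(* [(S w)(n)] is the sum over [m] of [s n m * w m]; [Series] is real valued,
   so real and imaginary parts are summed separately (see [S_op_series]). *)
Definition S_op (d : nat -> nat) (p : nat -> R) (w : nat -> C) (n : nat) : C :=
  (Series (fun m => Re (RtoC (s d p n m) * w m)%C),
   Series (fun m => Im (RtoC (s d p n m) * w m)%C)).

Definition point_spectrum (E : (nat -> C) -> Prop)
    (T : (nat -> C) -> nat -> C) (lambda : C) : Prop :=
  exists w : nat -> C,
    E w /\ (exists n, w n <> RtoC 0) /\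
    (forall n, T w n = (lambda * w n)%C).

Definition sigma_p_l1 (d : nat -> nat) (p : nat -> R) : C -> Prop :=
  point_spectrum l1 (S_op d p).

Definition radix (d : nat -> nat) : Prop :=
  d 0 = 1 /\ (forall j, 1 <= j -> 2 <= d j).

Lemma q_gt (d : nat -> nat) (k : nat) : radix d -> k < q d k.
Proof.
intros [d0 d2]; induction k as [|k IH]; simpl; [lia|].
specialize (d2 (S k) ltac:(lia)); nia.
Qed.

Lemma digit_lt (d : nat -> nat) (n j : nat) :
  radix d -> 1 <= j -> digit d n j < d j.
Proof.
intros [_ d2] Hj; apply Nat.mod_upper_bound; specialize (d2 j Hj); lia.
Qed.

Lemma mod_q_expansion (d : nat -> nat) (n k : nat) :
  radix d -> n mod q d k = nsum (fun j => digit d n j * q d (j - 1)) k.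
Proof.
intros rd; induction k as [|k IH]; simpl nsum.
- simpl; rewrite (proj1 rd); apply Nat.mod_1_r.
- rewrite <- IH; simpl q; unfold digit; replace (S k - 1) with k by lia.
  rewrite Nat.sub_0_r, Nat.Div0.mod_mul_r; f_equal; apply Nat.mul_comm.
Qed.

Lemma digit_expansion (d : nat -> nat) (n k : nat) :
  radix d -> n <= k -> n = nsum (fun j => digit d n j * q d (j - 1)) k.
Proof.
intros rd Hk; rewrite <- mod_q_expansion by assumption.
symmetry; apply Nat.mod_small; pose proof (q_gt d k rd); lia.
Qed.

Lemma digit_unique (d b : nat -> nat) (n k : nat) :
  radix d -> (forall j, 1 <= j <= k -> b j < d j) ->
  n = nsum (fun j => b j * q d (j - 1)) k ->
  (forall j, 1 <= j <= k -> digit d n j = b j) /\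
  (forall j, k < j -> digit d n j = 0).
Proof.
intros rd Hb ->.
assert (lt : forall i, i <= k ->
          nsum (fun j => b j * q d (j - 1)) i < q d i).
{ induction i as [|i IH]; intros Hi; simpl; [rewrite (proj1 rd); lia|].
  specialize (IH ltac:(lia)); specialize (Hb (S i) ltac:(lia)).
  rewrite Nat.sub_0_r.
  assert (b (S i) * q d i + q d i <= q d i * d (S i)) by nia; lia. }
split.
- intros j Hj; revert lt Hb; induction k as [|k IH]; [lia|]; intros lt Hb.
  pose proof (q_gt d k rd); pose proof (q_gt d (j - 1) rd).
  pose proof (lt k ltac:(lia)).
  destruct (Nat.eq_dec j (S k)) as [->|ne]; unfold digit; simpl nsum;
    rewrite ?Nat.sub_succ, ?Nat.sub_0_r.
  + rewrite Nat.div_add, Nat.div_small by lia.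
    apply Nat.mod_small, Hb; lia.
  + rewrite <- IH by (try lia; intros; try apply lt; try apply Hb; lia).
    unfold digit.
    assert (dv : exists c, q d k = c * d j * q d (j - 1)).
    { assert (forall i, exists c, q d (j + i) = c * d j * q d (j - 1)) as dv.
      { induction i as [|i [c Hc]].
        - exists 1; rewrite Nat.add_0_r; destruct j; [lia|]; simpl.
          rewrite Nat.sub_0_r; lia.
        - exists (c * d (S (j + i))); rewrite Nat.add_succ_r; simpl; lia. }
      destruct (dv (k - j)) as [c Hc]; exists c; rewrite <- Hc; f_equal; lia. }
    destruct dv as [c ->].
    rewrite (Nat.mul_assoc (b (S k))), Nat.div_add by lia.
    rewrite (Nat.mul_assoc (b (S k)) c); apply Nat.Div0.mod_add.
- intros j Hj; unfold digit.
  rewrite Nat.div_small; [apply Nat.Div0.mod_0_l|].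
  assert (mono : forall i, q d k <= q d (k + i)).
  { induction i as [|i IH]; [rewrite Nat.add_0_r; lia|].
    rewrite Nat.add_succ_r; simpl.
    pose proof (proj2 rd (S (k + i)) ltac:(lia)); nia. }
  specialize (mono (j - 1 - k)); replace (k + (j - 1 - k)) with (j - 1) in mono by lia.
  pose proof (lt k ltac:(lia)); lia.
Qed.

Lemma zeta_spec (d : nat -> nat) (n : nat) :
  radix d ->
  1 <= zeta d n /\ digit d n (zeta d n) <> d (zeta d n) - 1 /\
  (forall j, 1 <= j < zeta d n -> digit d n j = d j - 1).
Proof.
intros rd.
assert (last : digit d n (n + 1) <> d (n + 1) - 1).
{ unfold digit; replace (n + 1 - 1) with n by lia.
  rewrite Nat.div_small by (apply q_gt, rd); rewrite Nat.Div0.mod_0_l.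
  pose proof (proj2 rd (n + 1) ltac:(lia)); lia. }
assert (gen : forall f j, j + f = n + 1 ->
   let z := first_nonmax d n f j in
   j <= z /\ digit d n z <> d z - 1 /\
   (forall i, j <= i < z -> digit d n i = d i - 1)).
{ induction f as [|f IH]; intros j Hj; simpl.
  - replace j with (n + 1) by lia; repeat split; auto; intros; lia.
  - destruct (Nat.eqb_spec (digit d n j) (d j - 1)) as [e|ne].
    + destruct (IH (S j) ltac:(lia)) as (A & B & Cc).
      repeat split; [lia|exact B|]; intros i Hi.
      destruct (Nat.eq_dec i j) as [->|]; [exact e|apply Cc; lia].
    + repeat split; auto; intros; lia. }
exact (gen n 1 ltac:(lia)).
Qed.

Lemma drop_lt (d : nat -> nat) (r r' : nat) :
  radix d -> r < r' -> drop d r < drop d r'.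
Proof.
intros rd; induction 1 as [|r' H IH]; unfold drop in *; simpl;
  rewrite Nat.sub_0_r.
- pose proof (proj2 rd (S r) ltac:(lia)); pose proof (q_gt d r rd); nia.
- exact (Nat.lt_le_trans _ _ _ IH (Nat.le_add_r _ _)).
Qed.

Lemma drop_le (d : nat -> nat) (n r : nat) :
  radix d -> r < zeta d n -> drop d r <= n.
Proof.
intros rd Hr.
transitivity (n mod q d r); [|apply Nat.Div0.mod_le].
rewrite mod_q_expansion by assumption; unfold drop.
destruct (zeta_spec d n rd) as (_ & _ & H).
induction r as [|r IH]; simpl; [lia|].
rewrite (H (S r)) by lia; specialize (IH ltac:(lia)); lia.
Qed.

Lemma s_succ (d : nat -> nat) (p : nat -> R) (n : nat) :
  s d p n (n + 1) = pprod p (zeta d n).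
Proof. unfold s; now rewrite Nat.eqb_refl. Qed.

Lemma s_diag (d : nat -> nat) (p : nat -> R) (n : nat) :
  s d p n n = (1 - p 1%nat)%R.
Proof.
unfold s; rewrite Nat.eqb_refl.
now destruct (Nat.eqb_spec n (n + 1)); [lia|].
Qed.

Lemma sum_n_m_zero_in (a : nat -> R) (k l : nat) :
  (forall i, k <= i <= l -> a i = 0%R) -> sum_n_m a k l = 0%R.
Proof.
intros H; rewrite (sum_n_m_ext_loc a (fun _ => zero)) by exact H.
apply (sum_n_m_const_zero (G := R_AbelianMonoid)).
Qed.

Lemma s_drop (d : nat -> nat) (p : nat -> R) (n r : nat) :
  radix d -> 1 <= r <= zeta d n - 1 ->
  s d p n (n - drop d r) = ((1 - p (r + 1)%nat) * pprod p r)%R.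
Proof.
intros rd Hr.
assert (le : forall i, i <= zeta d n - 1 -> drop d i <= n)
  by (intros; apply drop_le; [assumption|lia]).
pose proof (le r ltac:(lia)).
assert (0 < drop d r) by exact (drop_lt d 0 r rd ltac:(lia)).
unfold s.
destruct (Nat.eqb_spec (n - drop d r) (n + 1)); [lia|].
destruct (Nat.eqb_spec (n - drop d r) n); [lia|].
assert (off : forall i, i <= zeta d n - 1 -> i <> r ->
          (n - drop d r =? n - drop d i) = false).
{ intros i Hi ne; apply Nat.eqb_neq; pose proof (le i Hi).
  destruct (Nat.lt_total i r) as [l|[l|l]]; [|lia|];
    pose proof (drop_lt d _ _ rd l); lia. }
rewrite (sum_n_m_Chasles _ 1 r) by lia.
rewrite (sum_n_m_zero_in _ (S r))
  by (intros i Hi; rewrite off by lia; reflexivity).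
rewrite (sum_n_m_Chasles _ 1 (r - 1) r) by lia.
rewrite (sum_n_m_zero_in _ 1)
  by (intros i Hi; rewrite off by lia; reflexivity).
replace (S (r - 1)) with r by lia; rewrite sum_n_n, Nat.eqb_refl.
unfold plus; simpl; lra.
Qed.

Lemma s_other (d : nat -> nat) (p : nat -> R) (n m : nat) :
  m <> n + 1 -> m <> n ->
  (forall r, 1 <= r <= zeta d n - 1 -> m <> n - drop d r) ->
  s d p n m = 0%R.
Proof.
intros H1 H2 H3; unfold s.
apply Nat.eqb_neq in H1, H2; rewrite H1, H2.
apply sum_n_m_zero_in; intros r Hr.
specialize (H3 r Hr); apply Nat.eqb_neq in H3; now rewrite H3.
Qed.

Lemma is_series_finite (a : nat -> R) (N : nat) :
  (forall m, N < m -> a m = 0%R) -> is_series a (sum_n a N).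
Proof.
intros H.
apply (filterlim_ext_loc (fun _ => sum_n a N)); [|apply filterlim_const].
exists N; intros k Hk; unfold sum_n.
destruct (Nat.eq_dec k N) as [->|ne]; [reflexivity|].
change (@sum_n_m R_AbelianMonoid a 0 N = @sum_n_m R_AbelianMonoid a 0 k).
rewrite (sum_n_m_Chasles (G := R_AbelianMonoid) a 0 N k) by lia.
rewrite (sum_n_m_zero_in a (S N) k) by (intros; apply H; lia).
now rewrite (@plus_zero_r R_AbelianMonoid).
Qed.

Lemma S_op_series (d : nat -> nat) (p : nat -> R) (w : nat -> C) (n : nat) :
  is_series (fun m => (RtoC (s d p n m) * w m)%C) (S_op d p w n).
Proof.
assert (Z : forall m, n + 1 < m -> (RtoC (s d p n m) * w m)%C = RtoC 0).
{ intros m Hm; rewrite s_other by (intros; lia); apply Cmult_0_l. }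
assert (HR : ex_series (fun m => Re (RtoC (s d p n m) * w m)%C)).
{ eexists; apply (is_series_finite _ (n + 1)).
  intros m Hm; now rewrite Z. }
assert (HI : ex_series (fun m => Im (RtoC (s d p n m) * w m)%C)).
{ eexists; apply (is_series_finite _ (n + 1)).
  intros m Hm; now rewrite Z. }
apply Series_correct in HR, HI.
assert (E : forall a k, @sum_n C_AbelianGroup a k =
   (sum_n (fun m => Re (a m)) k, sum_n (fun m => Im (a m)) k) :> C).
{ intros a k; induction k as [|k IH]; [rewrite !sum_O; now destruct (a 0)|].
  rewrite !sum_Sn, IH; reflexivity. }
unfold is_series in *.
eapply filterlim_ext; [intros k; symmetry; apply E|].
intros P [e He]; unfold filtermap.
generalize (filter_and _ _ (proj1 (filterlim_locally _ _) HR e)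
                         (proj1 (filterlim_locally _ _) HI e)).
apply filter_imp; intros k Hk; apply He; exact Hk.
Qed.

(* Main.v *)
Require Import Defs.
From Stdlib Require Import Reals Lra Lia Arith.
From Coquelicot Require Import Coquelicot.

Local Open Scope nat_scope.

(** An eigenvector [w] is forced by its first entry: [w (q k) = h_k * w 0], where
    [h_0 = (lambda - (1 - p_1)) / p_1] and
    [p_{k+2} h_{k+1} = h_k ^ d_{k+1} - (1 - p_{k+2})].
    As [w] is summable, so is [h]; once [|h_k| <= 1] the recurrence gives
    [1 - p_{k+2} <= |h_k| + |h_{k+1}|], so [1 - p] is summable and the infinite
    product of the positive numbers [p_j] is positive. *)

(** * Positional arithmetic *)

Lemma q_dvd (d : nat -> nat) (j i : nat) : exists e, q d (j + i) = e * q d j.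
Proof.
induction i as [|i [e He]].
- exists 1; rewrite Nat.add_0_r; lia.
- exists (e * d (S (j + i))); rewrite Nat.add_succ_r; simpl; rewrite He; ring.
Qed.

Lemma q_lt_succ (d : nat -> nat) (k : nat) : radix d -> q d k < q d (S k).
Proof.
intros rd; pose proof (q_gt d k rd); pose proof (proj2 rd (S k) ltac:(lia)).
simpl; nia.
Qed.

(** The terms telescope: [(d j - 1) * q d (j - 1)] is [q d j - q d (j - 1)]. *)
Lemma drop_succ_q (d : nat -> nat) (k : nat) : radix d -> drop d k + 1 = q d k.
Proof.
intros rd; induction k as [|k IH]; unfold drop in *; simpl.
- now rewrite (proj1 rd).
- rewrite Nat.sub_0_r.
  pose proof (proj2 rd (S k) ltac:(lia)); nia.
Qed.

Lemma zeta_unique (d : nat -> nat) (n z : nat) :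
  radix d -> 1 <= z -> digit d n z <> d z - 1 ->
  (forall j, 1 <= j < z -> digit d n j = d j - 1) -> zeta d n = z.
Proof.
intros rd Hz H1 H2; destruct (zeta_spec d n rd) as (A & B & D).
destruct (Nat.lt_total (zeta d n) z) as [l|[e|l]]; [|exact e|].
- now elim B; apply H2.
- now elim H1; apply D.
Qed.

Lemma div_pred_mul (a b : nat) : 0 < b -> (S a * b - 1) / b = a.
Proof.
intros Hb; symmetry; apply (Nat.div_unique _ _ _ (b - 1)); [lia|nia].
Qed.

(** The number [S c * q d k - 1] is [c * q d k] plus [k] maximal low digits, so its digit of index
    [k + 1] is [c mod d (S k)]. *)
Lemma zeta_before_multiple (d : nat -> nat) (c k : nat) :
  radix d -> c mod d (S k) <> d (S k) - 1 -> zeta d (S c * q d k - 1) = S k.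
Proof.
intros rd Hc; apply zeta_unique; [assumption|lia| |].
- unfold digit; rewrite Nat.sub_succ, Nat.sub_0_r.
  rewrite div_pred_mul; [exact Hc|pose proof (q_gt d k rd); lia].
- intros [|i] Hi; [lia|]; unfold digit; rewrite Nat.sub_succ, Nat.sub_0_r.
  (* With [q d k = e * q d (S i)], the quotient by [q d i] is [S c * e * d (S i) - 1], which is -1
     modulo [d (S i)]. *)
  destruct (q_dvd d (S i) (k - S i)) as [e He].
  replace (S i + (k - S i)) with k in He by lia.
  pose proof (q_gt d k rd); pose proof (q_gt d i rd).
  pose proof (proj2 rd (S i) ltac:(lia)).
  assert (0 < e) by (destruct e; lia).
  rewrite He; simpl q.
  replace (S c * (e * (q d i * d (S i))))
    with (S (S c * e * d (S i) - 1) * q d i) by nia.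
  rewrite div_pred_mul by lia.
  symmetry; apply (Nat.mod_unique _ _ (S c * e - 1)); nia.
Qed.

(** Take [k = zeta d n - 1]: the [k] low digits of [n] are maximal, so [n mod q d k] is [q d k - 1],
    and [c] is the quotient. *)
Lemma zeta_decomposition (d : nat -> nat) (n : nat) :
  radix d -> exists c k, n + 1 = S c * q d k /\ c mod d (S k) <> d (S k) - 1.
Proof.
intros rd; destruct (zeta_spec d n rd) as (A & B & D).
destruct (zeta d n) as [|k] eqn:Hz; [lia|].
exists (n / q d k), k; split.
- assert (E : n mod q d k = drop d k).
  { rewrite mod_q_expansion by assumption; clear -D; unfold drop.
    induction k as [|k IH]; simpl; [reflexivity|].
    rewrite IH by (intros; apply D; lia); now rewrite D by lia. }
  pose proof (drop_succ_q d k rd).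
  pose proof (Nat.div_mod_eq n (q d k)); nia.
- unfold digit in B; now rewrite Nat.sub_succ, Nat.sub_0_r in B.
Qed.

(** * Rows of the transition matrix *)

(** The backward jumps of row [n], all of them when [k = zeta d n - 1]. The cut-off [k] is free so
    that the sum can be built up one jump at a time. *)
Definition returns (d : nat -> nat) (p : nat -> R) (w : nat -> C) (n k : nat) : C :=
  sum_n_m (G := C_AbelianGroup)
    (fun r => RtoC ((1 - p (r + 1)%nat) * pprod p r) * w (n - drop d r)%nat)%C 1 k.

Lemma returns_succ (d : nat -> nat) (p : nat -> R) (w : nat -> C) (n k : nat) :
  returns d p w n (S k) =
  (returns d p w n k
   + RtoC ((1 - p (S k + 1)%nat) * pprod p (S k)) * w (n - drop d (S k))%nat)%C.
Proof. unfold returns; now rewrite sum_n_Sm by lia. Qed.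

Lemma is_series_single (f : nat -> R) (m0 : nat) :
  is_series (fun m => if m =? m0 then f m else 0%R) (f m0).
Proof.
assert (E : sum_n (fun m => if m =? m0 then f m else 0%R) m0 = f m0).
{ destruct m0 as [|m0]; [now rewrite sum_O|].
  rewrite sum_Sn, Nat.eqb_refl; unfold sum_n.
  rewrite sum_n_m_zero_in; [apply Rplus_0_l|].
  intros i Hi; now destruct (Nat.eqb_spec i (S m0)); [lia|]. }
rewrite <- E; apply is_series_finite.
intros m Hm; now destruct (Nat.eqb_spec m m0); [lia|].
Qed.

Lemma is_series_sum_n_m (a : nat -> nat -> R) (l : nat -> R) (k : nat) :
  (forall r, is_series (a r) (l r)) ->
  is_series (fun m => sum_n_m (fun r => a r m) 1 k) (sum_n_m l 1 k).
Proof.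
intros H; induction k as [|k IH].
- rewrite sum_n_m_zero by lia.
  eapply is_series_ext; [intros m; symmetry; apply sum_n_m_zero; lia|].
  replace (@zero R_AbelianMonoid) with (sum_n (fun _ => 0%R) 0)
    by (rewrite sum_O; reflexivity).
  now apply is_series_finite.
- rewrite sum_n_Sm by lia.
  eapply is_series_ext; [intros m; symmetry; apply sum_n_Sm; lia|].
  exact (is_series_plus _ _ _ _ IH (H (S k))).
Qed.

(** The columns [n + 1] and [n] and those of the backward jumps are disjoint, so the case
    distinction in [s] is a sum of series with one nonzero term at most. *)
Lemma row_series (d : nat -> nat) (p : nat -> R) (u : nat -> R) (n : nat) :
  radix d ->
  Series (fun m => s d p n m * u m)%R =
  (pprod p (zeta d n) * u (n + 1)%nat + (1 - p 1%nat) * u n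
   + sum_n_m (fun r => (1 - p (r + 1)%nat) * pprod p r * u (n - drop d r)%nat)%R
       1 (zeta d n - 1))%R.
Proof.
intros rd; apply is_series_unique.
eapply is_series_ext; cycle 1.
- apply (is_series_plus (V := R_NormedModule)).
  + apply (is_series_plus (V := R_NormedModule)).
    * apply (is_series_single (fun m => pprod p (zeta d n) * u m)%R).
    * apply (is_series_single (fun m => (1 - p 1%nat) * u m)%R).
  + apply is_series_sum_n_m; intros r.
    apply (is_series_single
             (fun m => (1 - p (r + 1)%nat) * pprod p r * u m)%R).
- intros m; cbv beta; unfold s, plus; simpl.
  (* Backward jumps land strictly below [n], since [0 < drop d r <= n]. *)
  assert (H0 : n <= m -> sum_n_m (G := R_AbelianMonoid)
     (fun r => if m =? n - drop d r
        then ((1 - p (r + 1)%nat) * pprod p r * u m)%R else 0%R : R) 1 (zeta d n - 1) = 0%R :> R).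
  { intros Hm; apply sum_n_m_zero_in; intros r Hr.
    pose proof (drop_le d n r rd ltac:(lia)).
    pose proof (drop_lt d 0 r rd ltac:(lia)).
    now destruct (Nat.eqb_spec m (n - drop d r)); [lia|]. }
  destruct (Nat.eqb_spec m (n + 1)) as [e1|n1].
  { destruct (Nat.eqb_spec m n); [lia|].
    etransitivity; [apply (f_equal (Rplus _) (H0 ltac:(lia)))|lra]. }
  destruct (Nat.eqb_spec m n) as [e2|n2].
  { etransitivity; [apply (f_equal (Rplus _) (H0 ltac:(lia)))|lra]. }
  rewrite !Rplus_0_l, Rmult_comm.
  etransitivity; [|apply (sum_n_m_mult_l (K := R_Ring) (u m))].
  apply sum_n_m_ext; intros r; unfold mult; simpl.
  destruct (m =? n - drop d r); ring.
Qed.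

Lemma S_op_row (d : nat -> nat) (p : nat -> R) (w : nat -> C) (n : nat) :
  radix d ->
  S_op d p w n =
  (RtoC (pprod p (zeta d n)) * w (n + 1)%nat + RtoC (1 - p 1%nat) * w n
   + returns d p w n (zeta d n - 1))%C.
Proof.
intros rd.
assert (E : forall k, returns d p w n k =
  (sum_n_m (fun r => (1 - p (r + 1)%nat) * pprod p r * Re (w (n - drop d r)%nat))%R 1 k,
   sum_n_m (fun r => (1 - p (r + 1)%nat) * pprod p r * Im (w (n - drop d r)%nat))%R 1 k)).
{ induction k as [|k IH].
  - unfold returns; now rewrite !sum_n_m_zero by lia.
  - rewrite returns_succ, IH, !sum_n_Sm by lia.
    apply injective_projections; simpl; unfold plus, Re, Im; simpl; ring. }
unfold S_op.
rewrite (Series_ext _ (fun m => s d p n m * Re (w m))%R)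
  by (intros; apply re_scal_l).
rewrite (Series_ext (fun m => Im _) (fun m => s d p n m * Im (w m))%R)
  by (intros; apply im_scal_l).
rewrite !row_series, E by assumption.
apply injective_projections; simpl; unfold Re, Im; ring.
Qed.

(** * The multipliers of an eigenvector *)

Fixpoint multiplier (d : nat -> nat) (p : nat -> R) (lambda : C) (k : nat) : C :=
  match k with
  | 0 => ((lambda - RtoC (1 - p 1%nat)) / RtoC (p 1%nat))%C
  | S i => ((Cpow (multiplier d p lambda i) (d k) - RtoC (1 - p (S k)))
            / RtoC (p (S k)))%C
  end.

Lemma pprod_pos (p : nat -> R) (k : nat) :
  (forall j : nat, 1 <= j -> (0 < p j <= 1)%R) -> (0 < pprod p k)%R.
Proof.
intros hp; induction k as [|k IH]; simpl; [lra|].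
apply Rmult_lt_0_compat; [exact IH|apply hp; lia].
Qed.

Section Eigenvector.

Variables (d : nat -> nat) (p : nat -> R) (lambda : C) (w : nat -> C).
Hypothesis rd : radix d.
Hypothesis hp : forall j : nat, 1 <= j -> (0 < p j <= 1)%R.
Hypothesis eigen : forall n, S_op d p w n = (lambda * w n)%C.

Let h := multiplier d p lambda.

Lemma RtoC_p_neq0 (k : nat) : RtoC (p (S k)) <> RtoC 0.
Proof.
intros E; apply RtoC_inj in E; specialize (hp (S k) ltac:(lia)); lra.
Qed.

(** The condition on [c] says that adding [q d k] to [c * q d k] raises digit [k + 1] without a
    carry. *)
Definition multiplicative (k : nat) : Prop :=
  forall c, c mod d (S k) <> d (S k) - 1 ->
  w (S c * q d k)%nat = (h k * w (c * q d k)%nat)%C.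

(* The forward term of row [n = (c + 1) q_k - 1], computed even when
   [zeta d n > k + 1], which is what the step from [k] to [k + 1] needs. *)
Definition forward_term (k : nat) : Prop :=
  forall c, let n := S c * q d k - 1 in
  (lambda * w n - RtoC (1 - p 1%nat) * w n - returns d p w n k)%C =
  (RtoC (pprod p (S k)) * h k * w (c * q d k)%nat)%C.

(** Without a carry, row [S c * q d k - 1] has [zeta] equal to [k + 1], so the forward term is
    [pprod p (S k) * w (S c * q d k)]; divide by the positive product. *)
Lemma multiplicative_of_forward (k : nat) : forward_term k -> multiplicative k.
Proof.
intros F c Hc; specialize (F c); cbv zeta in F.
pose proof (S_op_row d p w (S c * q d k - 1) rd) as E.
rewrite eigen, zeta_before_multiple in E by assumption.
pose proof (q_gt d k rd).
replace (S c * q d k - 1 + 1) with (S c * q d k) in E by nia.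
replace (S k - 1) with k in E by lia.
rewrite E in F.
assert (P0 : RtoC (pprod p (S k)) <> RtoC 0).
{ intros e; apply RtoC_inj in e; pose proof (pprod_pos p (S k) hp); lra. }
transitivity (/ RtoC (pprod p (S k))
   * (RtoC (pprod p (S k)) * w (S c * q d k)%nat))%C; [now field|].
transitivity (/ RtoC (pprod p (S k))
   * (RtoC (pprod p (S k)) * h k * w (c * q d k)%nat))%C; [|now field].
f_equal; rewrite <- F; ring.
Qed.

Lemma multiplicative_pow (k c a : nat) :
  multiplicative k -> a < d (S k) ->
  w ((c * d (S k) + a) * q d k)%nat = (Cpow (h k) a * w (c * q d (S k))%nat)%C.
Proof.
intros M; induction a as [|a IH]; intros Ha.
- simpl; rewrite Cmult_1_l; f_equal; ring.
- rewrite Nat.add_succ_r, M, IH, Cpow_S by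
    (rewrite ?(Nat.add_comm (c * _)), ?Nat.Div0.mod_add, ?Nat.mod_small; lia).
  ring.
Qed.

Lemma forward_term_0 : forward_term 0.
Proof.
intros c n; subst n; unfold returns; rewrite sum_n_m_zero by lia; simpl q.
rewrite (proj1 rd), !Nat.mul_1_r; replace (S c - 1) with c by lia.
change (@zero C_AbelianGroup) with (RtoC 0); simpl pprod; unfold h; simpl.
rewrite RtoC_mult; field; apply RtoC_p_neq0.
Qed.

(** Read the same row at level [k], with last digit [d (S k) - 1]: its forward term carries the
    factor [h k] to the power [d (S k)]. Subtracting the one further backward jump yields the
    recurrence that defines [h (S k)]. *)
Lemma forward_term_succ (k : nat) :
  forward_term k -> multiplicative k -> forward_term (S k).
Proof.
intros F M c n.
pose proof (proj2 rd (S k) ltac:(lia)) as D.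
assert (En : n = S (c * d (S k) + (d (S k) - 1)) * q d k - 1)
  by (unfold n; simpl q; f_equal; nia).
specialize (F (c * d (S k) + (d (S k) - 1))); cbv zeta in F; rewrite <- En in F.
rewrite returns_succ.
(* The new jump clears all [k + 1] maximal low digits. *)
assert (Ed : n - drop d (S k) = c * q d (S k)).
{ unfold n; pose proof (drop_succ_q d (S k) rd); nia. }
rewrite Ed.
assert (Eh : RtoC (p (S (S k))) <> RtoC 0) by apply RtoC_p_neq0.
transitivity (RtoC (pprod p (S k)) * (h k * Cpow (h k) (d (S k) - 1))
   * w (c * q d (S k))%nat - RtoC ((1 - p (S k + 1)%nat) * pprod p (S k)) * w (c * q d (S k))%nat)%C.
- rewrite multiplicative_pow in F by (assumption || lia).
  transitivity (RtoC (pprod p (S k)) * h k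
    * (Cpow (h k) (d (S k) - 1) * w (c * q d (S k))%nat)
    - RtoC ((1 - p (S k + 1)%nat) * pprod p (S k)) * w (c * q d (S k))%nat)%C; [|ring].
  rewrite <- F; ring.
- rewrite <- Cpow_S; replace (S (d (S k) - 1)) with (d (S k)) by lia.
  change (h (S k)) with ((Cpow (h k) (d (S k)) - RtoC (1 - p (S (S k))))
            / RtoC (p (S (S k))))%C.
  change (pprod p (S (S k))) with (pprod p (S k) * p (S (S k)))%R.
  rewrite Nat.add_1_r, !RtoC_mult; now field.
Qed.

Lemma eigenvector_multiplicative (k : nat) : multiplicative k.
Proof.
apply multiplicative_of_forward.
induction k as [|k IH]; [apply forward_term_0|].
apply forward_term_succ; [exact IH|now apply multiplicative_of_forward].
Qed.

Lemma eigenvector_q (k : nat) : w (q d k) = (h k * w 0)%C.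
Proof.
pose proof (eigenvector_multiplicative k 0) as E.
rewrite Nat.mul_1_l in E; apply E.
pose proof (proj2 rd (S k) ltac:(lia)); rewrite Nat.mod_small; lia.
Qed.

(** Strong induction: [n + 1 = S c * q d k] without a carry, so [w (n + 1)] is a multiple of the
    earlier entry [w (c * q d k)]. *)
Lemma eigenvector_eq0 : w 0 = RtoC 0 -> forall n, w n = RtoC 0.
Proof.
intros w0 n; induction n as [[|n] IH] using lt_wf_ind; [exact w0|].
destruct (zeta_decomposition d n rd) as (c & k & E & Hc).
pose proof (q_gt d k rd).
rewrite <- Nat.add_1_r, E, eigenvector_multiplicative, IH by (assumption || nia).
apply Cmult_0_r.
Qed.

(** Solve the recurrence for [1 - p (S (S k))] and apply the triangle inequality; a positive power
    of a modulus at most 1 is at most that modulus, and [p (S (S k)) <= 1]. *)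
Lemma multiplier_defect (k : nat) :
  (Cmod (h k) <= 1)%R ->
  (1 - p (S (S k)) <= Cmod (h k) + Cmod (h (S k)))%R.
Proof.
intros Hk; pose proof (hp (S (S k)) ltac:(lia)) as Hp.
assert (E : RtoC (1 - p (S (S k))) =
   (Cpow (h k) (d (S k)) + - (RtoC (p (S (S k))) * h (S k)))%C).
{ change (h (S k)) with ((Cpow (h k) (d (S k)) - RtoC (1 - p (S (S k))))
            / RtoC (p (S (S k))))%C; field; apply RtoC_p_neq0. }
apply (f_equal Cmod) in E.
pose proof (Cmod_triangle (Cpow (h k) (d (S k))) (- (RtoC (p (S (S k))) * h (S k)))) as T.
rewrite <- E, Cmod_opp, Cmod_mult, !Cmod_R, Cmod_pow in T.
rewrite !Rabs_pos_eq in T by lra.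
pose proof (Cmod_ge_0 (h k)); pose proof (Cmod_ge_0 (h (S k))).
assert (Cmod (h k) ^ d (S k) <= Cmod (h k))%R.
{ pose proof (proj2 rd (S k) ltac:(lia)).
  destruct (d (S k)) as [|e]; [lia|]; simpl.
  pose proof (pow_incr (Cmod (h k)) 1 e ltac:(lra)) as I; rewrite pow1 in I; nra. }
nra.
Qed.

End Eigenvector.

(** * Summability *)

Lemma ex_series_subsequence (a : nat -> R) (phi : nat -> nat) :
  (forall n, 0 <= a n)%R -> (forall k, phi k < phi (S k)) ->
  ex_series a -> ex_series (fun k => a (phi k)).
Proof.
intros a0 Hphi [l Hl].
assert (mono : forall n m, (sum_n a n <= sum_n a (n + m)%nat)%R).
{ intros n; induction m as [|m IH]; [rewrite Nat.add_0_r; lra|].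
  rewrite Nat.add_succ_r, sum_Sn; specialize (a0 (S (n + m))).
  unfold plus; simpl in *; lra. }
assert (bound : forall n, (sum_n a n <= l)%R).
{ intros n; apply (is_lim_seq_incr_compare (sum_n a) l Hl).
  intros i; specialize (mono i 1); now rewrite Nat.add_1_r in mono. }
(* The indices that [phi] skips contribute nonnegative terms. *)
assert (sub : forall k, (sum_n (fun k => a (phi k)) k <= sum_n a (phi k))%R).
{ induction k as [|k IH].
  - rewrite sum_O; destruct (phi 0) as [|n]; [rewrite sum_O; lra|].
    rewrite sum_Sn; pose proof (mono 0 n) as I; rewrite sum_O in I; simpl in I.
    pose proof (a0 0); unfold plus; simpl; lra.
  - rewrite sum_Sn; specialize (Hphi k); destruct (phi (S k)) as [|n]; [lia|].
    rewrite sum_Sn; pose proof (mono (phi k) (n - phi k)) as I.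
    replace (phi k + (n - phi k)) with n in I by lia.
    unfold plus in *; simpl in *; lra. }
destruct (ex_finite_lim_seq_incr (sum_n (fun k => a (phi k))) l) as [l' Hl'].
- intros k; rewrite sum_Sn; specialize (a0 (phi (S k))); unfold plus; simpl; lra.
- intros k; specialize (sub k); specialize (bound (phi k)); lra.
- now exists l'.
Qed.

(** Weierstrass's inequality: a product of factors [1 - x_j] with [x_j] in [0,1) is at least 1 minus
    the sum of the [x_j]. Nonnegativity of the sum is carried along for the induction step. *)
Lemma pprod_lower_bound (p : nat -> R) (N n : nat) :
  (forall j : nat, 1 <= j -> (0 < p j <= 1)%R) ->
  let x := sum_n_m (fun j => (1 - p j)%R) (S N) (N + n) in
  (0 <= x)%R /\ (pprod p N * (1 - x) <= pprod p (N + n))%R.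
Proof.
intros hp; induction n as [|n [IH1 IH2]]; cbv zeta in *.
- rewrite Nat.add_0_r, sum_n_m_zero by lia; unfold zero; simpl; lra.
- rewrite Nat.add_succ_r, sum_n_Sm by lia; simpl pprod; unfold plus; simpl plus in *.
  pose proof (hp (S (N + n)) ltac:(lia)); pose proof (pprod_pos p N hp).
  simpl; split; [lra|].
  set (x := sum_n_m _ _ _) in *; set (y := p (S (N + n))) in *.
  assert (pprod p N * (1 - x) * y <= pprod p (N + n) * y)%R
    by (apply Rmult_le_compat_r; lra).
  (* The slack is [(1 - x) * y - (1 - x - (1 - y)) = x * (1 - y)]. *)
  assert (0 <= pprod p N * (x * (1 - y)))%R
    by (repeat apply Rmult_le_pos; lra).
  nra.
Qed.

(** Choose [N] with all later block sums of [1 - p j] below 1/2; from there on the products stay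
    above [pprod p N / 2]. *)
Lemma pprod_lim_not_0 (p : nat -> R) :
  (forall j : nat, 1 <= j -> (0 < p j <= 1)%R) ->
  ex_series (fun j => 1 - p j)%R -> ~ is_lim_seq (pprod p) 0%R.
Proof.
intros hp Hs H0.
destruct (Cauchy_ex_series _ Hs (mkposreal (1 / 2) ltac:(lra))) as [N HN].
pose proof (pprod_pos p N hp).
apply (is_lim_seq_incr_n _ N) in H0.
assert (L : Rbar_le (pprod p N / 2)%R 0%R).
{ apply (is_lim_seq_le (fun _ => pprod p N / 2)%R (fun n => pprod p (n + N)));
    [|apply is_lim_seq_const|exact H0].
  intros n; rewrite Nat.add_comm.
  destruct (pprod_lower_bound p N n hp) as [A B].
  destruct n as [|n]; [rewrite Nat.add_0_r; lra|].
  specialize (HN (S N) (N + S n) ltac:(lia) ltac:(lia)).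
  set (x := sum_n_m _ _ _) in A, B; change (Rabs x < 1 / 2)%R in HN.
  apply Rabs_lt_between in HN; nra. }
simpl in L; lra.
Qed.

Theorem proposition4p11 (d : nat -> nat) (p : nat -> R)
  (hd0 : d 0%nat = 1%nat)
  (hd : forall j : nat, (1 <= j)%nat -> (2 <= d j)%nat)
  (hp : forall j : nat, (1 <= j)%nat -> (0 < p j <= 1)%R)
  (hprod : is_lim_seq (pprod p) 0%R) :
  forall lambda : C, ~ sigma_p_l1 d p lambda.
Proof.
intros lambda (w & Hl & (n & Hn) & eigen).
assert (rd : radix d) by (split; assumption).
assert (w0 : w 0%nat <> RtoC 0).
{ intros e; apply Hn; exact (eigenvector_eq0 d p lambda w rd hp eigen e n). }
apply Cmod_gt_0 in w0.
set (h := multiplier d p lambda).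
assert (Hh : ex_series (fun k => Cmod (h k))).
(* As [w 0] is nonzero, [h k] is [w (q d k) / w 0], and [q d] is strictly increasing. *)
{ apply (ex_series_ext (fun k => scal (/ Cmod (w 0%nat)) (Cmod (w (q d k))))).
  - intros k; rewrite (eigenvector_q d p lambda w rd hp eigen), Cmod_mult.
    unfold scal; simpl; unfold mult; simpl; fold h; field; lra.
  - apply (ex_series_scal (V := R_NormedModule)).
    apply (ex_series_subsequence (fun m => Cmod (w m))); [|intros; now apply q_lt_succ|exact Hl].
    intros; apply Cmod_ge_0. }
apply (pprod_lim_not_0 p hp); [|exact hprod].
pose proof (ex_series_lim_0 _ Hh) as L.
apply is_lim_seq_spec in L; destruct (L (mkposreal 1 ltac:(lra))) as [K HK].
simpl in HK.
(* The defect at index [K + k + 2] is controlled by [h] at [K + k] and [K + k + 1], where the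
   modulus at [K + k] is already below 1. *)
apply (ex_series_incr_n _ (S (S K))).
apply (ex_series_le (V := R_CompleteNormedModule)
  _ (fun k => plus (Cmod (h (K + k)%nat)) (Cmod (h (S K + k)%nat)))).
- intros k; unfold norm; simpl; unfold abs; simpl.
  pose proof (hp (S (S (K + k))) ltac:(lia)).
  rewrite Rabs_pos_eq by lra.
  apply (multiplier_defect d p lambda rd hp).
  specialize (HK (K + k)%nat ltac:(lia)); apply Rabs_lt_between in HK.
  fold h; lra.
- apply (ex_series_plus (V := R_NormedModule)).
  + now apply (ex_series_incr_n (fun k => Cmod (h k)) K).
  + now apply (ex_series_incr_n (fun k => Cmod (h k)) (S K)).
Qed.
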